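(* Let $(A,\succ,\prec)$ be a Leibniz-dendriform algebra and $(B,\diamond)$ a (left) Zinbiel algebra over a field $\mathbb K$. Define a binary operation $\cdot$ on $A\otimes B$ by $$(a\otimes x)\cdot(b\otimes y)=(a\succ b)\otimes (x\diamond y)-(b\prec a)\otimes (y\diamond x),\qquad a,b\in A,\ x,y\in B,$$ extended bilinearly. Then $(A\otimes B,\cdot)$ is a pre-Lie algebra.
   Context: All vector spaces are over a field $\mathbb K$. Standing convention of the paper: algebras are finite-dimensional, except $\mathbb Z$-graded ones, which may be infinite-dimensional. A pre-Lie algebra is a vector space $L$ with a bilinear product $\cdot$ satisfying $(x\cdot y)\cdot z-x\cdot(y\cdot z)=(y\cdot x)\cdot z-y\cdot(x\cdot z)$ for all $x,y,z\in L$. A Leibniz-dendriform algebra $(A,\succ,\prec)$ is a vector space with two bilinear operations $\succ,\prec:A\otimes A\to A$ such that, with $x\circ y:=x\succ y+x\prec y$, for all $x,y,z\in A$: $(x\circ y)\succ z=x\succ(y\succ z)-y\succ(x\succ z)$; $y\prec(x\circ z)+(x\succ y)\prec z=x\succ(y\prec z)$; $x\prec(y\circ z)=(x\prec y)\prec z+y\succ(x\prec z)$. A (left) Zinbiel algebra $(B,\diamond)$ is a vector space with a bilinear operation satisfying $x\diamond(y\diamond z)=(x\diamond y)\diamond z+(y\diamond x)\diamond z$ for all $x,y,z\in B$. *)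

(* Defs.v *)
From HB Require Import structures.
From mathcomp Require Import all_boot all_algebra.
From mathcomp Require Import boolp.
From mathcomp Require Import freeg.

Set Implicit Arguments.
Unset Strict Implicit.
Unset Printing Implicit Defensive.

Import GRing.Theory.

Local Open Scope ring_scope.
Local Open Scope quotient_scope.

(* The tensor product is the free vector space on [A * B], modulo the subspace
   generated by the bilinearity relations.  The spaces may have any dimension.
   Classical logic turns the subspace into a boolean predicate, as the quotient
   construction requires. *)

Section TensorProduct.
Variables (K : fieldType) (A B : lmodType K).

Definition free_pairs : lmodType K := {freeg (A * B)%type / K}.

Definition free_pair (a : A) (x : B) : free_pairs := << (a, x) >>.

Inductive tensor_relation : free_pairs -> Prop :=
  | RelLeft k a a' x : tensor_relation
      (free_pair (k *: a + a') x - (k *: free_pair a x + free_pair a' x))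
  | RelRight k a x x' : tensor_relation
      (free_pair a (k *: x + x') - (k *: free_pair a x + free_pair a x')).

Inductive tensor_null_span : free_pairs -> Prop :=
  | SpanRel u : tensor_relation u -> tensor_null_span u
  | Span0 : tensor_null_span 0
  | SpanLin k u v :
      tensor_null_span u -> tensor_null_span v -> tensor_null_span (k *: u + v).

Definition tensor_null : {pred free_pairs} := fun u => `[< tensor_null_span u >].

Lemma tensor_nullP u : reflect (tensor_null_span u) (u \in tensor_null).
Proof. exact: asboolP. Qed.

Fact tensor_null_zmod_closed : zmod_closed tensor_null.
Proof.
split=> [|u v /tensor_nullP nu /tensor_nullP nv]; apply/tensor_nullP.
  exact: Span0.
by rewrite addrC -scaleN1r; apply: SpanLin.
Qed.

HB.instance Definition _ :=
  GRing.isZmodClosed.Build free_pairs tensor_null tensor_null_zmod_closed.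

Definition tensor : Type := @Quotient.quot free_pairs tensor_null.

HB.instance Definition _ := GRing.Zmodule.on tensor.
HB.instance Definition _ :=
  ZmodQuotient.copy tensor (@Quotient.quot free_pairs tensor_null).

Lemma tensor_eqP (u v : free_pairs) :
  reflect (tensor_null_span (u - v)) (\pi_tensor u == \pi_tensor v).
Proof. by rewrite -[_ == _]Quotient.idealrBE; apply: tensor_nullP. Qed.

Lemma tensorW (P : tensor -> Prop) :
  (forall u, P (\pi_tensor u)) -> forall t, P t.
Proof. by move=> Ppi t; rewrite -[t]reprK. Qed.

Definition tensor_scale (k : K) (t : tensor) : tensor :=
  \pi_tensor (k *: repr t).

Lemma tensor_scale_pi k u : tensor_scale k (\pi_tensor u) = \pi_tensor (k *: u).
Proof.
apply/eqP/tensor_eqP; rewrite -scalerBr -[_ *: _]addr0.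
apply: SpanLin; last exact: Span0.
by apply/tensor_eqP; rewrite reprK.
Qed.

Fact tensor_scaleA k l t :
  tensor_scale k (tensor_scale l t) = tensor_scale (k * l) t.
Proof. by elim/tensorW: t => u; rewrite !tensor_scale_pi scalerA. Qed.

Fact tensor_scale1 : left_id 1 tensor_scale.
Proof. by elim/tensorW=> u; rewrite tensor_scale_pi scale1r. Qed.

Fact tensor_scaleDr : right_distributive tensor_scale +%R.
Proof.
move=> k; elim/tensorW=> u; elim/tensorW=> v.
by rewrite -raddfD !tensor_scale_pi scalerDr raddfD.
Qed.

Fact tensor_scaleDl t : {morph tensor_scale^~ t : k l / k + l}.
Proof.
by move=> k l; elim/tensorW: t => u; rewrite !tensor_scale_pi scalerDl raddfD.
Qed.

HB.instance Definition _ := GRing.Zmodule_isLmodule.Build K tensor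
  tensor_scaleA tensor_scale1 tensor_scaleDr tensor_scaleDl.

Lemma scale_pi k u : k *: \pi_tensor u = \pi_tensor (k *: u).
Proof. exact: tensor_scale_pi. Qed.

Definition tensor_pure (a : A) (x : B) : tensor := \pi_tensor (free_pair a x).

Fact tensor_pure_bilinear : bilinear_for *:%R *:%R tensor_pure.
Proof.
by split=> [x k a a'|a k x x']; rewrite /tensor_pure /= scale_pi -raddfD;
   apply/eqP/tensor_eqP/SpanRel; [apply: RelLeft | apply: RelRight].
Qed.

HB.instance Definition _ := bilinear_isBilinear.Build K A B tensor
  *:%R *:%R tensor_pure tensor_pure_bilinear.

Section UniversalProperty.
Variables (V : lmodType K) (f : {bilinear A -> B -> V}).

Let free_lift (u : free_pairs) : V := fglift (fun p => f p.1 p.2) u.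

Definition tensor_lift (t : tensor) : V := free_lift (repr t).

Let free_liftB : zmod_morphism free_lift.
Proof. exact: lift_is_additive. Qed.

Let free_liftZ k u : free_lift (k *: u) = k *: free_lift u.
Proof.
have lift0 : free_lift 0 = 0 by rewrite -[0 in LHS](subrr 0) free_liftB subrr.
have liftD : {morph free_lift : u v / u + v}.
  by move=> v w; rewrite -[w in LHS]opprK free_liftB -[- w]sub0r free_liftB
    lift0 sub0r opprK.
have liftS (s : seq (A * B)) (F : A * B -> free_pairs) :
    free_lift (\sum_(p <- s) F p) = \sum_(p <- s) free_lift (F p).
  exact: (big_morph free_lift liftD lift0).
rewrite -{2}[u]freeg_sumE [k *: u]/(fgscale k u) /fgscale !liftS scaler_sumr.
by apply: eq_bigr => p _; rewrite /free_lift !liftU scalerA.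
Qed.

Let free_lift_linear : linear free_lift.
Proof.
move=> k u v; rewrite -[v in LHS]opprK free_liftB free_liftZ -[- v]scaleN1r.
by rewrite free_liftZ scaleN1r opprK.
Qed.

Let free_lift_null u : tensor_null_span u -> free_lift u = 0.
Proof.
elim=> [{}u [] * | | k {}u v _ u0 _ v0].
- rewrite free_liftB free_lift_linear /free_lift !liftU !scale1r /=.
  by rewrite linearPl subrr.
- rewrite free_liftB free_lift_linear /free_lift !liftU !scale1r /=.
  by rewrite linearPr subrr.
- by rewrite -(subrr 0) free_liftB subrr.
- by rewrite free_lift_linear u0 v0 scaler0 addr0.
Qed.

Let tensor_lift_pi u : tensor_lift (\pi_tensor u) = free_lift u.
Proof.
apply/eqP; rewrite -subr_eq0 -free_liftB; apply/eqP/free_lift_null.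
by apply/tensor_eqP; rewrite reprK.
Qed.

Fact tensor_lift_linear : linear tensor_lift.
Proof.
move=> k; elim/tensorW=> u; elim/tensorW=> v.
by rewrite scale_pi -raddfD !tensor_lift_pi free_lift_linear.
Qed.

HB.instance Definition _ :=
  GRing.isLinear.Build K tensor V *:%R tensor_lift tensor_lift_linear.

Lemma tensor_liftE a x : tensor_lift (tensor_pure a x) = f a x.
Proof. by rewrite tensor_lift_pi /free_lift liftU scale1r. Qed.

End UniversalProperty.

Lemma tensor_ind (P : tensor -> Prop) :
    (forall a x, P (tensor_pure a x)) ->
    (forall t u, P t -> P u -> P (t + u)) ->
  forall t, P t.
Proof.
move=> Ppure PD; elim/tensorW=> u; rewrite -[u]freeg_sumE.
have P0 : P 0 by rewrite -[0](linear0r tensor_pure 0).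
elim: (dom u) => [|[a x] s IHs]; first by rewrite big_nil raddf0.
rewrite big_cons raddfD /=; apply: PD => //.
rewrite (_ : \pi _ = tensor_pure (coeff (a, x) u *: a) x) //.
rewrite linearZl_LR [RHS]scale_pi; congr \pi_tensor.
by apply/eqP/freeg_eqP=> p; rewrite coeffZ !coeffU mul1r.
Qed.

Lemma tensor_lift_unique (V : lmodType K) (g h : {linear tensor -> V}) :
  (forall a x, g (tensor_pure a x) = h (tensor_pure a x)) -> g =1 h.
Proof.
move=> gh; apply: tensor_ind => // t u gt gu.
by rewrite !linearD gt gu.
Qed.

End TensorProduct.

Notation "A \otimes B" := (tensor A B)
  (at level 40, left associativity) : type_scope.
Notation "a \otimes x" := (tensor_pure a x)
  (at level 40, left associativity) : ring_scope.

Section Algebras.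
Variables (K : fieldType) (V : lmodType K).

Definition pre_Lie (mul : {bilinear V -> V -> V}) : Prop :=
  forall x y z,
    mul (mul x y) z - mul x (mul y z) = mul (mul y x) z - mul y (mul x z).

Record Leibniz_dendriform (succ prec : {bilinear V -> V -> V}) : Prop := {
  dendriform_succ : forall x y z,
    succ (succ x y + prec x y) z = succ x (succ y z) - succ y (succ x z);
  dendriform_mid : forall x y z,
    prec y (succ x z + prec x z) + prec (succ x y) z = succ x (prec y z);
  dendriform_prec : forall x y z,
    prec x (succ y z + prec y z) = prec (prec x y) z + succ y (prec x z)
}.

Definition left_Zinbiel (dia : {bilinear V -> V -> V}) : Prop :=
  forall x y z, dia x (dia y z) = dia (dia x y) z + dia (dia y x) z.

End Algebras.

(* Main.v *)
Require Import Defs.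
From HB Require Import structures.
From mathcomp Require Import all_boot all_algebra.

Set Implicit Arguments.
Unset Strict Implicit.
Unset Printing Implicit Defensive.

Import GRing.Theory.

Local Open Scope ring_scope.

(** Write [o] for the sum of [succ] and [prec]. On pure tensors [u], [v], [w]
    with A-parts [a], [b], [c] and B-parts [x], [y], [z], the commutator
    [u v - v u] is [(a o b) \otimes xy - (b o a) \otimes yx], and the pre-Lie
    identity says that left multiplication by it is the commutator of the left
    multiplications by [u] and [v].  The axioms make
    [((a o b) \otimes xy) w + v (u w)] symmetric under exchanging [(a, x)] with
    [(b, y)]; subtracting the exchanged equation gives the identity. *)

Section TensorBilinear.
Variables (K : fieldType) (A1 A2 A3 B1 B2 B3 : lmodType K).
Variables (f : {bilinear A1 -> A2 -> A3}) (g : {bilinear B1 -> B2 -> B3}).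

(** The tensor product of [f] and [g] is built by lifting twice: first in [(b, y)] with [a] and [x]
    fixed, then in [(a, x)] with the right-hand tensor fixed. *)
Definition tensor_bilin_pure (a : A1) (x : B1) (b : A2) (y : B2) :=
  f a b \otimes g x y.

Fact tensor_bilin_pure_bilinear a x :
  bilinear_for *:%R *:%R (tensor_bilin_pure a x).
Proof.
by split=> [y k b b'|b k y y']; rewrite /tensor_bilin_pure/= ?linearPr ?linearPl.
Qed.

HB.instance Definition _ a x := bilinear_isBilinear.Build K A2 B2 (A3 \otimes B3)%type
  *:%R *:%R (tensor_bilin_pure a x) (tensor_bilin_pure_bilinear a x).

Definition tensor_bilin_left (u : A2 \otimes B2) (a : A1) (x : B1) :=
  tensor_lift (tensor_bilin_pure a x) u.

Fact tensor_bilin_left_bilinear u :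
  bilinear_for *:%R *:%R (tensor_bilin_left u).
Proof.
(* The lift provides linearity in [u] only; linearity in [a] and in [x] comes by induction on
   [u]. *)
split=> [x k a a'|a k x x']; rewrite /tensor_bilin_left/=;
  elim/tensor_ind: u => [b y|u v IHu IHv];
  rewrite ?tensor_liftE ?linearD /= ?IHu ?IHv ?scalerDr 1?addrACA //;
  by rewrite /tensor_bilin_pure ?(linearPl, linearPr).
Qed.

HB.instance Definition _ u := bilinear_isBilinear.Build K A1 B1 (A3 \otimes B3)%type
  *:%R *:%R (tensor_bilin_left u) (tensor_bilin_left_bilinear u).

Definition tensor_bilin (t : A1 \otimes B1) (u : A2 \otimes B2) :=
  tensor_lift (tensor_bilin_left u) t.

Lemma tensor_bilinE a x b y :
  tensor_bilin (a \otimes x) (b \otimes y) = f a b \otimes g x y.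
Proof. by rewrite /tensor_bilin tensor_liftE /= /tensor_bilin_left tensor_liftE. Qed.

Fact tensor_bilin_bilinear : bilinear_for *:%R *:%R tensor_bilin.
Proof.
split=> [u k t t'|t k u u']; rewrite /tensor_bilin/=; first exact: linearP.
elim/tensor_ind: t => [a x|s t IHs IHt].
  by rewrite !tensor_liftE /= /tensor_bilin_left linearP.
by rewrite !linearD /= IHs IHt addrACA.
Qed.

HB.instance Definition _ :=
  bilinear_isBilinear.Build K (A1 \otimes B1)%type (A2 \otimes B2)%type (A3 \otimes B3)%type
  *:%R *:%R tensor_bilin tensor_bilin_bilinear.

End TensorBilinear.

Lemma tensor_bilinear_ext (K : fieldType) (A1 A2 B1 B2 V : lmodType K)
    (f g : {bilinear A1 \otimes B1 -> A2 \otimes B2 -> V}) :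
  (forall a b x y, f (a \otimes x) (b \otimes y) = g (a \otimes x) (b \otimes y)) ->
  forall t u, f t u = g t u.
Proof.
move=> fg; elim/tensor_ind=> [a x|s t IHs IHt] u; last first.
  by rewrite !linearDl IHs IHt.
by elim/tensor_ind: u => [b y|u v IHu IHv]; rewrite ?linearDr ?IHu ?IHv.
Qed.

Lemma tensor_pre_Lie (K : fieldType) (A B : lmodType K)
    (mul : {bilinear A \otimes B -> A \otimes B -> A \otimes B}) :
  (forall a b c x y z,
    let u := a \otimes x in let v := b \otimes y in let w := c \otimes z in
    mul (mul u v) w - mul u (mul v w) = mul (mul v u) w - mul v (mul u w)) ->
  pre_Lie mul.
Proof.
move=> mul_pure u v w.
elim/tensor_ind: u => [a x|u u' IHu IHu']; last first.
  by rewrite !(linearDl, linearDr) /= !opprD addrACA IHu IHu' addrACA.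
elim/tensor_ind: v => [b y|v v' IHv IHv']; last first.
  by rewrite !(linearDl, linearDr) /= !opprD addrACA IHv IHv' addrACA.
elim/tensor_ind: w => [c z|w w' IHw IHw']; last first.
  by rewrite !linearDr /= !opprD addrACA IHw IHw' addrACA.
exact: mul_pure.
Qed.

Section DendriformZinbiel.
Variables (K : fieldType) (A B : lmodType K).
Variables (succ prec : {bilinear A -> A -> A}) (dia : {bilinear B -> B -> B}).

Definition dendriform_Zinbiel_mul (t u : A \otimes B) : A \otimes B :=
  tensor_bilin succ dia t u - tensor_bilin prec dia u t.

Lemma dendriform_Zinbiel_mulE a b x y :
  dendriform_Zinbiel_mul (a \otimes x) (b \otimes y)
    = succ a b \otimes dia x y - prec b a \otimes dia y x.
Proof. by rewrite /dendriform_Zinbiel_mul !tensor_bilinE. Qed.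

Fact dendriform_Zinbiel_mul_bilinear :
  bilinear_for *:%R *:%R dendriform_Zinbiel_mul.
Proof.
by split=> [u k t t'|t k u u']; rewrite /dendriform_Zinbiel_mul/= linearPl linearPr
  opprD addrACA scalerBr.
Qed.

HB.instance Definition _ := bilinear_isBilinear.Build K
  (A \otimes B)%type (A \otimes B)%type (A \otimes B)%type *:%R *:%R
  dendriform_Zinbiel_mul dendriform_Zinbiel_mul_bilinear.

Local Notation "t \cdot u" := (dendriform_Zinbiel_mul t u)
  (at level 40, left associativity).

(** The [prec] term of each product carries the same B-part as the [succ] term of the other, and the
    two minus signs make them add up. *)
Lemma dendriform_Zinbiel_mul_comm a b x y :
  (a \otimes x) \cdot (b \otimes y) - (b \otimes y) \cdot (a \otimes x)
    = (succ a b + prec a b) \otimes dia x y - (succ b a + prec b a) \otimes dia y x.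
Proof.
by rewrite !dendriform_Zinbiel_mulE !linearDl opprD opprK !opprD addrACA
  [- _ + prec a b \otimes _]addrC addrACA [- (succ b a \otimes _) - _]addrC.
Qed.

Hypotheses (dendA : Leibniz_dendriform succ prec) (zinbB : left_Zinbiel dia).

(** Exchanging [(a, x)] with [(b, y)] only permutes the summands inside each bracket on the
    right. *)
Lemma dendriform_Zinbiel_mul_sym a b c x y z :
  ((succ a b + prec a b) \otimes dia x y) \cdot (c \otimes z)
      + (b \otimes y) \cdot ((a \otimes x) \cdot (c \otimes z))
    = (succ a (succ b c) \otimes dia (dia x y) z
        + succ b (succ a c) \otimes dia (dia y x) z)
      - (succ a (prec c b) \otimes dia x (dia z y)
        + succ b (prec c a) \otimes dia y (dia z x)).
Proof.
case: dendA => sA mA pA.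
(* Expand [dia z (dia x y)] and [dia x (dia z y)] by the Zinbiel identity. The A-parts in front of
   [dia (dia z x) y] then agree by [pA], those in front of [dia (dia x z) y] by [mA]. *)
have key : prec c (succ a b + prec a b) \otimes dia z (dia x y)
      + prec (succ a c) b \otimes dia (dia x z) y
    = prec (prec c a) b \otimes dia (dia z x) y
      + succ a (prec c b) \otimes dia x (dia z y).
  rewrite !zinbB; move: (pA c a b) (mA a c b).
  move: (prec c (_ + _)) (prec (succ a c) b) (prec (prec c a) b) (succ a (prec c b)).
  (* The occurrence numbers select [p] in front of [dia (dia z x) y] and [s] in front of
     [dia (dia x z) y]. *)
  move=> p q r s prs pqs; rewrite !linearDr /= {1}prs -{2}pqs !linearDl /=.
  by rewrite -!addrA; congr (_ + _); rewrite addrC -addrA.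
rewrite /dendriform_Zinbiel_mul !tensor_bilinE !linearBr !linearBl /= !tensor_bilinE.
(* The term [succ b (succ a c) \otimes dia (dia x y) z] now appears with a minus sign from [sA] and
   a plus sign from the Zinbiel identity, so it will cancel. *)
rewrite sA linearBl [dia y (dia x z)]zinbB [_ \otimes (_ + _)]linearDr /=.
move: key.
set P := prec c _ \otimes _; set Q := prec (succ a c) b \otimes _.
set R := prec (prec c a) b \otimes _; set S := succ a (prec c b) \otimes _.
move=> /(canRL (addrK Q)) ->.
move: (_ \otimes _) (_ \otimes _) (_ \otimes _) (_ \otimes _) Q R S.
move=> V U Y X Q R S; rewrite !opprB addrACA [U + Y]addrC -[Y + U - V]addrA subrKA.
rewrite [Q - _ + _]addrC subrKA !opprD [R + _]addrA subrr add0r.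
by rewrite -!addrA [- S + _]addrC.
Qed.

Lemma dendriform_Zinbiel_mul_pre_Lie : pre_Lie dendriform_Zinbiel_mul.
Proof.
apply: tensor_pre_Lie => a b c x y z.
move=> u v w; apply/eqP; rewrite /= subr_eq -addrA addrC -subr_eq; apply/eqP.
rewrite -linearBl /= dendriform_Zinbiel_mul_comm linearBl /=.
rewrite (canRL (addrK _) (dendriform_Zinbiel_mul_sym a b c x y z)).
rewrite (canRL (addrK _) (dendriform_Zinbiel_mul_sym b a c y x z)) -/u -/v -/w.
(* Reordering both brackets of one instance makes the symmetric parts of the two instances
   identical; their difference leaves [u \cdot (v \cdot w) - v \cdot (u \cdot w)]. *)
rewrite [succ b (succ a c) \otimes dia (dia y x) z + _]addrC.
rewrite [succ b (prec c a) \otimes dia y (dia z x) + _]addrC.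
by rewrite opprB [LHS]addrC subrKA addrC.
Qed.

End DendriformZinbiel.

Theorem proposition2p4 (K : fieldType) (A B : lmodType K)
    (succ prec : {bilinear A -> A -> A}) (dia : {bilinear B -> B -> B})
    (dendA : Leibniz_dendriform succ prec) (zinbB : left_Zinbiel dia) :
  exists mul : {bilinear A \otimes B -> A \otimes B -> A \otimes B},
    [/\ forall a b x y,
          mul (a \otimes x) (b \otimes y)
            = succ a b \otimes dia x y - prec b a \otimes dia y x,
        forall mul' : {bilinear A \otimes B -> A \otimes B -> A \otimes B},
          (forall a b x y,
            mul' (a \otimes x) (b \otimes y)
              = succ a b \otimes dia x y - prec b a \otimes dia y x) ->
          forall t u, mul' t u = mul t u
      & pre_Lie mul].
Proof.
exists (dendriform_Zinbiel_mul succ prec dia).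
split=> [a b x y|mul' mul'E|].
- exact: dendriform_Zinbiel_mulE.
- apply: tensor_bilinear_ext => a b x y.
  by rewrite mul'E /= dendriform_Zinbiel_mulE.
- exact: dendriform_Zinbiel_mul_pre_Lie.
Qed.
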